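(* Let $P$ and $Q$ be $n\times n$ complex matrices. Then for every $r\in\mathbb{N}$, $$\mathbf{ber}^{2r}\left(\begin{bmatrix}0&P\\Q&0\end{bmatrix}\right)\leq\frac14\max\left\{\mathbf{ber}\big(|Q|^{4r}+P(|P|^2)^\dagger P^*\big),\mathbf{ber}\big(|P|^{4r}+Q(|Q|^2)^\dagger Q^*\big)\right\}+\frac12\max\left\{\mathbf{ber}\big(P(|P|^2)^\dagger P^*|Q|^{2r}\big),\mathbf{ber}\big(Q(|Q|^2)^\dagger Q^*|P|^{2r}\big)\right\}.$$
   Context: $\mathbb{N}=\{1,2,3,\dots\}$. $T^*$ is the adjoint, $|T|=\sqrt{T^*T}$ (so $|T|^2=T^*T$), and $T^\dagger$ is the Moore–Penrose inverse. $\mathbb{C}^n$ with its standard inner product is regarded as a reproducing kernel Hilbert space of functions on $\{1,\dots,n\}$; its reproducing kernels are the standard basis vectors $e_1,\dots,e_n$. Thus for an $n\times n$ matrix $T$, the Berezin number is $\mathbf{ber}(T)=\max_{j}|\langle Te_j,e_j\rangle|$. The direct sum $\mathbb{C}^n\oplus\mathbb{C}^n$ is regarded as a reproducing kernel Hilbert space on the product set $\{1,\dots,n\}\times\{1,\dots,n\}$, the reproducing kernel at $(i,j)$ being $(e_i,e_j)$, with normalized kernel $\hat k_{(i,j)}=\frac{1}{\sqrt2}(e_i,e_j)$. For a $2\times2$ block matrix $M$ with $n\times n$ blocks, acting on $\mathbb{C}^n\oplus\mathbb{C}^n$, $\mathbf{ber}(M)=\max_{i,j}|\langle M\hat k_{(i,j)},\hat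 k_{(i,j)}\rangle|$. $\mathbf{ber}^p(T)$ means $(\mathbf{ber}(T))^p$. *)

(* Defs.v *)
From HB Require Import structures.
From mathcomp Require Import all_boot all_order all_algebra.
From mathcomp Require Import sesquilinear spectral.
From mathcomp Require Import complex.
From mathcomp Require Import classical_sets reals.

Set Implicit Arguments.
Unset Strict Implicit.
Unset Printing Implicit Defensive.

Import Order.TTheory GRing.Theory Num.Theory.
Local Open Scope ring_scope.
Local Open Scope sesquilinear_scope.
Local Open Scope classical_set_scope.

Section MatrixOperators.
Variable C : numClosedFieldType.

(* Linear in the first argument, conjugate-linear in the second. *)
Definition inner n (u v : 'cV[C]_n) : C := (v ^t* *m u) 0 0.

Definition psdmx n (A : 'M[C]_n) : Prop :=
  A ^t* = A /\ forall u : 'cV[C]_n, 0 <= inner (A *m u) u.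

(* The default value 0 is only taken when A is not positive semidefinite; see
   [sqrtmxP] and [sqrtmx_unique]. *)
Definition sqrtmx n (A : 'M[C]_n) : 'M[C]_n :=
  xget 0 [set B | psdmx B /\ B *m B = A].

Definition absmx n (A : 'M[C]_n) : 'M[C]_n := sqrtmx (A ^t* *m A).

Definition penrose m n (A : 'M[C]_(m, n)) (X : 'M[C]_(n, m)) : Prop :=
  [/\ A *m X *m A = A, X *m A *m X = X,
      (A *m X) ^t* = A *m X & (X *m A) ^t* = X *m A].

(* The default value 0 is never taken; see [mpinvP] and [mpinv_unique]. *)
Definition mpinv m n (A : 'M[C]_(m, n)) : 'M[C]_(n, m) :=
  xget 0 [set X | penrose A X].

Lemma adjM m n p (A : 'M[C]_(m, n)) (B : 'M[C]_(n, p)) :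
  (A *m B) ^t* = B ^t* *m A ^t*.
Proof. by rewrite trmx_mul map_mxM. Qed.

Lemma adjB m n (A B : 'M[C]_(m, n)) : (A - B) ^t* = A ^t* - B ^t*.
Proof. by rewrite linearB /= map_mxB. Qed.

Lemma adj_mul_eq0 m n (A : 'M[C]_(m, n)) : A ^t* *m A = 0 -> A = 0.
Proof.
move=> A0; apply/matrixP => i j; rewrite mxE.
have /matrixP/(_ j j) := A0; rewrite !mxE => /eqP; rewrite psumr_eq0; last first.
  by move=> k _; rewrite !mxE mulrC mul_conjC_ge0.
move=> /allP/(_ i (mem_index_enum _)); rewrite !mxE mulrC mul_conjC_eq0.
by move=> /eqP.
Qed.

Lemma inner_ge0 n (u : 'cV[C]_n) : 0 <= inner u u.
Proof.
by rewrite /inner mxE; apply: sumr_ge0 => k _; rewrite !mxE mulrC mul_conjC_ge0.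
Qed.

Lemma inner_eq0 n (u : 'cV[C]_n) : inner u u = 0 -> u = 0.
Proof.
by move=> u0; apply: adj_mul_eq0; apply/matrixP => i j; rewrite !ord1 [RHS]mxE.
Qed.

Lemma innerM n m (A : 'M[C]_(m, n)) (u : 'cV[C]_n) (v : 'cV[C]_m) :
  inner (A *m u) v = inner u (A ^t* *m v).
Proof. by rewrite /inner adjM trmxCK mulmxA. Qed.

Lemma psdmx_gram m n (A : 'M[C]_(m, n)) : psdmx (A ^t* *m A).
Proof.
split; first by rewrite adjM trmxCK.
by move=> u; rewrite -mulmxA innerM trmxCK inner_ge0.
Qed.

Lemma sqrtmx_exists n (A : 'M[C]_n) :
  psdmx A -> exists B, psdmx B /\ B *m B = A.
Proof.
move=> [Ah Ap].
have Anormal : A \is normalmx by apply/normalmxP; rewrite Ah.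
have /orthomx_spectralP AE := Anormal.
pose U := spectralmx A; pose X := spectral_diag A.
have Uu : U \is unitarymx := spectral_unitarymx A.
have UU : U *m U ^t* = 1%:M by apply/unitarymxP.
rewrite invmx_unitary // -/U -/X in AE.
have Xge0 i : 0 <= X 0 i.
  have := Ap (U ^t* *m delta_mx i 0).
  rewrite AE /inner adjM trmxCK !mulmxA -(mulmxA _ U) UU mulmx1.
  rewrite -(mulmxA _ U) UU mulmx1.
  have -> : (delta_mx i 0 : 'cV[C]_n) ^t* = delta_mx 0 i.
    by rewrite trmx_delta map_delta_mx.
  by rewrite -rowE -colE !mxE eqxx mulr1n.
pose Y := map_mx sqrtC X.
have Yh : (diag_mx Y) ^t* = diag_mx Y.
  rewrite tr_diag_mx map_diag_mx; congr diag_mx; apply/rowP => j.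
  by rewrite !mxE; apply: geC0_conj; rewrite sqrtC_ge0.
have YY : diag_mx Y *m diag_mx Y = diag_mx X.
  rewrite mulmx_diag; congr diag_mx; apply/rowP => j.
  by rewrite !mxE -expr2 sqrtCK.
exists (U ^t* *m diag_mx Y *m U); split; last first.
  by rewrite !mulmxA -(mulmxA _ U) UU mulmx1 -(mulmxA _ _ (diag_mx Y)) YY -AE.
split; first by rewrite !adjM trmxCK Yh !mulmxA.
move=> u; rewrite -!mulmxA innerM trmxCK; set v := U *m u.
rewrite /inner mxE; apply: sumr_ge0 => k _.
rewrite mul_diag_mx !mxE mulrCA; apply: mulr_ge0; first by rewrite sqrtC_ge0.
by rewrite mulrC mul_conjC_ge0.
Qed.

Lemma sqrtmxP n (A : 'M[C]_n) :
  psdmx A -> psdmx (sqrtmx A) /\ sqrtmx A *m sqrtmx A = A.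
Proof. by move=> /sqrtmx_exists; exact: (@xgetPex _ 0). Qed.

Lemma tr_gramE m n (A : 'M[C]_(m, n)) :
  \tr (A ^t* *m A) = \sum_j inner (col j A) (col j A).
Proof.
apply: eq_bigr => j _; rewrite /inner !mxE.
by apply: eq_bigr => k _; rewrite !mxE.
Qed.

Lemma tr_gram_ge0 m n (A : 'M[C]_(m, n)) : 0 <= \tr (A ^t* *m A).
Proof. by rewrite tr_gramE; apply: sumr_ge0 => j _; exact: inner_ge0. Qed.

Lemma tr_gram_eq0 m n (A : 'M[C]_(m, n)) : \tr (A ^t* *m A) = 0 -> A = 0.
Proof.
rewrite tr_gramE => /eqP; rewrite psumr_eq0; last by move=> j _; exact: inner_ge0.
move=> /allP A0; apply/matrixP => i j; rewrite [RHS]mxE.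
have /eqP/inner_eq0/colP/(_ i) := A0 j (mem_index_enum _).
by rewrite !mxE.
Qed.

Lemma psdmx_sqr_inj n (A B : 'M[C]_n) :
  psdmx A -> psdmx B -> A *m A = B *m B -> A = B.
Proof.
move=> psdA psdB AB; pose D := A - B.
have Dh : D ^t* = D by rewrite adjB psdA.1 psdB.1.
have [S [[Sh _] SA]] := sqrtmx_exists psdA.
have [T [[Th _] TB]] := sqrtmx_exists psdB.
have gram (X : 'M[C]_n) : X ^t* = X -> (X *m D) ^t* *m (X *m D) = D *m (X *m X) *m D.
  by move=> Xh; rewrite adjM Dh Xh !mulmxA.
have E : A *m D + D *m B = 0.
  by rewrite mulmxBr mulmxBl AB addrA subrK subrr.
have : \tr ((S *m D) ^t* *m (S *m D)) + \tr ((T *m D) ^t* *m (T *m D)) = 0.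
  rewrite !gram // SA TB -mulmxA mxtrace_mulC -mxtraceD -mulmxDl E.
  by rewrite mul0mx mxtrace0.
move=> /eqP; rewrite paddr_eq0 ?tr_gram_ge0 // => /andP[/eqP SD /eqP TD].
have AD : A *m D = 0 by rewrite -SA -mulmxA (tr_gram_eq0 SD) mulmx0.
have BD : B *m D = 0 by rewrite -TB -mulmxA (tr_gram_eq0 TD) mulmx0.
apply/eqP; rewrite -subr_eq0 -/D; apply/eqP/adj_mul_eq0.
by rewrite Dh {1}/D mulmxBl AD BD subrr.
Qed.

Lemma sqrtmx_unique n (A B : 'M[C]_n) :
  psdmx B -> B *m B = A -> sqrtmx A = B.
Proof.
move=> psdB BA.
have [psdS SA] : psdmx (sqrtmx A) /\ sqrtmx A *m sqrtmx A = A.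
  by apply: (@xgetPex _ 0 [set S | psdmx S /\ S *m S = A]); exists B.
by apply: psdmx_sqr_inj => //; rewrite SA.
Qed.

Lemma absmx_sqr n (A : 'M[C]_n) : absmx A ^+ 2 = A ^t* *m A.
Proof. by rewrite expr2; have [] := sqrtmxP (psdmx_gram A). Qed.

Lemma gram_unit m n (A : 'M[C]_(m, n)) :
  row_full A -> A ^t* *m A \in unitmx.
Proof.
move=> Afull; rewrite -row_free_unit -kermx_eq0; apply/eqP.
set K := kermx _; have K0 : K *m (A ^t* *m A) = 0 by exact: mulmx_ker.
have : (A *m K ^t*) ^t* *m (A *m K ^t*) = 0.
  by rewrite adjM trmxCK !mulmxA -(mulmxA K) K0 mul0mx.
move=> /adj_mul_eq0 AK.
have [B BA] := row_fullP Afull.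
have : K ^t* = 0 by rewrite -[K ^t*]mul1mx -BA -mulmxA AK mulmx0.
by move=> K'0; rewrite -[K]trmxCK K'0 trmx0 map_mx0.
Qed.

Lemma penrose_exists m n (A : 'M[C]_(m, n)) : exists X, penrose A X.
Proof.
pose r := \rank A; pose F := col_base A; pose G := row_base A.
have AE : F *m G = A := mulmx_base A.
have Fu : F ^t* *m F \in unitmx.
  by apply: gram_unit; exact: col_base_full.
have Gu : G *m G ^t* \in unitmx.
  have := @gram_unit _ _ (G ^t*); rewrite trmxCK; apply.
  rewrite /row_full mxrank_map mxrank_tr.
  by have := row_base_free A; rewrite /row_free.
clearbody F G.
pose V := invmx (F ^t* *m F); pose W := invmx (G *m G ^t*).
have Vh : V ^t* = V by rewrite trmx_inv map_invmx adjM trmxCK.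
have Wh : W ^t* = W by rewrite trmx_inv map_invmx adjM trmxCK.
have VF : V *m F ^t* *m F = 1%:M by rewrite -mulmxA mulVmx.
have GW : G *m G ^t* *m W = 1%:M by rewrite mulmxV.
suff [X PX] : exists X, penrose (F *m G) X by exists X; rewrite -AE.
exists (G ^t* *m W *m V *m F ^t*).
have FX : F *m G *m (G ^t* *m W *m V *m F ^t*) = F *m V *m F ^t*.
  by rewrite -!mulmxA (mulmxA G) (mulmxA (G *m _)) GW mul1mx.
have XG : G ^t* *m W *m V *m F ^t* *m (F *m G) = G ^t* *m W *m G.
  by rewrite -!mulmxA (mulmxA (F ^t*)) (mulmxA V) (mulmxA V) VF mul1mx.
split.
- by rewrite FX -!mulmxA (mulmxA (F ^t*)) (mulmxA V) (mulmxA V) VF mul1mx.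
- by rewrite XG -!mulmxA (mulmxA G) (mulmxA (G *m _)) GW mul1mx.
- by rewrite FX !adjM trmxCK Vh mulmxA.
- by rewrite XG !adjM trmxCK Wh mulmxA.
Qed.

Lemma mpinvP m n (A : 'M[C]_(m, n)) : penrose A (mpinv A).
Proof. exact: (@xgetPex _ 0 [set X | penrose A X] (penrose_exists A)). Qed.

Lemma penrose_inj m n (A : 'M[C]_(m, n)) (X Y : 'M[C]_(n, m)) :
  penrose A X -> penrose A Y -> X = Y.
Proof.
move=> [X1 X2 X3 X4] [Y1 Y2 Y3 Y4].
have E1 : A *m X = A *m Y.
  have <- : A *m Y *m (A *m X) = A *m X by rewrite mulmxA Y1.
  by rewrite -[LHS]trmxCK adjM X3 Y3 mulmxA X1 Y3.
have E2 : X *m A = Y *m A.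
  have <- : X *m A *m (Y *m A) = X *m A by rewrite -mulmxA (mulmxA A) Y1.
  by rewrite -[LHS]trmxCK adjM X4 Y4 -mulmxA (mulmxA A) X1 Y4.
by rewrite -X2 -mulmxA E1 mulmxA E2 Y2.
Qed.

Lemma mpinv_unique m n (A : 'M[C]_(m, n)) (X : 'M[C]_(n, m)) :
  penrose A X -> mpinv A = X.
Proof. by move=> AX; apply: penrose_inj AX; exact: mpinvP. Qed.

End MatrixOperators.

Section Berezin.
Variable R : realType.

(* The Berezin number of T for a reproducing kernel Hilbert space inside C^m
   with finite index set I, khat i being the normalized reproducing kernel at
   the point i.  The maximum is over nonnegative reals, so the unit 0 of the
   iterated maximum is harmless when I is nonempty. *)
Definition berezin (I : finType) m (khat : I -> 'cV[R[i]]_m) (T : 'M[R[i]]_m) : R :=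
  \big[Num.max/0]_(x : I) ComplexField.Normc.normc (inner (T *m khat x) (khat x)).

Definition basis_vec n (j : 'I_n) : 'cV[R[i]]_n := delta_mx j 0.

Definition ber n (T : 'M[R[i]]_n) : R := berezin (@basis_vec n) T.

Definition block_kernel n (ij : 'I_n * 'I_n) : 'cV[R[i]]_(n + n) :=
  ((Num.sqrt 2%:R)^-1)%:C%C *: col_mx (basis_vec ij.1) (basis_vec ij.2).

Definition ber_block n (M : 'M[R[i]]_(n + n)) : R := berezin (@block_kernel n) M.

End Berezin.

(* Main.v *)
Require Import Defs.
From HB Require Import structures.
From mathcomp Require Import all_boot all_order all_algebra.
From mathcomp Require Import sesquilinear spectral.
From mathcomp Require Import complex.
From mathcomp Require Import reals.

Set Implicit Arguments.
Unset Strict Implicit.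
Unset Printing Implicit Defensive.

Import Order.TTheory GRing.Theory Num.Theory.
Local Open Scope ring_scope.
Local Open Scope sesquilinear_scope.

(** The idea is to prove a numerical bound for a single matrix [M] at a unit
    vector [x] and to evaluate it at the kernels of the direct sum for the
    off-diagonal matrix [M] with blocks [P] and [Q].

    Let [T] be the modulus of [M] and [E] the orthogonal projection onto the
    range of [M].  Then [<M x, x> = <M x, E x>], so Cauchy-Schwarz gives
    [|<M x, x>| ^ 2 <= <T ^ 2 x, x> <E x, x>].  In the [r]-th power of the right
    side, [<T ^ 2 x, x> ^ r] is at most [<T ^ (2 r) x, x>] ([mccarthy]) and
    [<E x, x> ^ r] is at most [<E x, x>], a number of [[0, 1]].  The product
    [<T ^ (2 r) x, x> <x, E x>] is of the form that Buzano's inequality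
    ([buzano]) bounds, by
    [(|T ^ (2 r) x| |E x| + |<E T ^ (2 r) x, x>|) / 2], and the inequality of
    the means gives [proj_abs_bound].

    For the off-diagonal [M], the matrices [T] and [E] are block diagonal: the
    blocks of [T] are the moduli of [Q] and [P], and those of [E] are the range
    projections of [P] and [Q], which are the matrices
    [P *m mpinv (absmx P ^+ 2) *m P ^t*] and its analogue for [Q]
    ([range_projP]).  The quadratic form of a block diagonal matrix at a kernel
    is the average of a diagonal entry of each block, hence is at most the
    larger of the two Berezin numbers ([normc_blockdiag_le]). *)

(** * Inequalities for the quadratic form of a matrix *)

Section InnerProduct.
Variables (C : numClosedFieldType) (n : nat).
Implicit Types (u v x a b : 'cV[C]_n) (T E : 'M[C]_n).

Lemma inner_dotmx u v : inner u v = dotmx u^T v^T.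
Proof.
by rewrite dotmxE /inner !mxE; apply: eq_bigr => k _; rewrite !mxE mulrC.
Qed.

Lemma innerDl a b u : inner (a + b) u = inner a u + inner b u.
Proof. by rewrite /inner mulmxDr mxE. Qed.

Lemma innerBl a b u : inner (a - b) u = inner a u - inner b u.
Proof. by rewrite /inner mulmxBr mxE [X in _ + X]mxE. Qed.

Lemma innerZl (c : C) a u : inner (c *: a) u = c * inner a u.
Proof. by rewrite /inner -scalemxAr mxE. Qed.

Lemma inner_conj u v : inner u v = (inner v u)^*.
Proof.
rewrite /inner !mxE rmorph_sum; apply: eq_bigr => k _.
by rewrite !mxE rmorphM /= conjCK mulrC.
Qed.

Lemma CauchySchwarz_inner u v :
  `|inner u v| ^+ 2 <= inner u u * inner v v.
Proof. by rewrite !inner_dotmx; apply: (CauchySchwarz (@dotmx C n)). Qed.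

Lemma CauchySchwarz_inner_sqrt u v :
  `|inner u v| <= sqrtC (inner u u) * sqrtC (inner v v).
Proof. by rewrite !inner_dotmx; apply: (CauchySchwarz_sqrt (@dotmx C n)). Qed.

(** Buzano's inequality: the vector [c] below is the reflection of [a] in the
    line spanned by [x], so it has the length of [a], and [inner c b] is
    [2 * (inner a x * inner x b) - inner a b]; Cauchy-Schwarz for [c] and [b]
    gives the bound. *)
Lemma buzano a b x : inner x x = 1 ->
  `|inner a x * inner x b| *+ 2 <=
  sqrtC (inner a a) * sqrtC (inner b b) + `|inner a b|.
Proof.
move=> x1; pose c := (inner a x *+ 2) *: x - a.
have cE w : inner c w = inner a x * inner x w *+ 2 - inner a w.
  by rewrite innerBl innerZl mulrnAl.
have cc : inner c c = inner a a.
  have xc : inner x c = (inner a x)^*.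
    by rewrite inner_conj cE x1 mulr1 mulr2n addrK.
  have ac : inner a c = (inner a x * (inner a x)^*) *+ 2 - inner a a.
    rewrite inner_conj cE (inner_conj x a) rmorphB rmorphMn rmorphM /= conjCK.
    by rewrite mulrC -(inner_conj a a).
  by rewrite cE xc ac opprB addrCA subrr addr0.
rewrite -cc -normrMn -[_ *+ 2](subrK (inner a b)) -cE.
by apply: le_trans (ler_normD _ _) _; rewrite lerD2r CauchySchwarz_inner_sqrt.
Qed.

Lemma adj_exp T k : T ^t* = T -> (T ^+ k) ^t* = T ^+ k.
Proof.
move=> Th; elim: k => [|k IH]; first by rewrite !expr0 trmx1 map_mx1.
by rewrite {1}exprS adjM IH Th -[_ *m _]exprSr.
Qed.

Lemma inner_exp_split T j k x : T ^t* = T ->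
  inner (T ^+ (j + k) *m x) x = inner (T ^+ k *m x) (T ^+ j *m x).
Proof.
by move=> Th; rewrite exprD -[_ * _]/(_ *m _) -mulmxA innerM adj_exp.
Qed.

(** The even moments of a Hermitian matrix at [x] are squared norms. *)
Lemma moment_ge0 T k x : T ^t* = T -> 0 <= inner (T ^+ (2 * k) *m x) x.
Proof. by move=> Th; rewrite mul2n -addnn inner_exp_split // inner_ge0. Qed.

(** Cauchy-Schwarz makes the sequence of even moments log-convex: a moment is
    the inner product of the two vectors whose squared norms are its
    neighbours. *)
Lemma moment_log_convex T k x : T ^t* = T ->
  inner (T ^+ (2 * k.+1) *m x) x ^+ 2 <=
  inner (T ^+ (2 * k) *m x) x * inner (T ^+ (2 * k.+2) *m x) x.
Proof.
move=> Th; have := moment_ge0 k.+1 x Th => /ger0_norm <-.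
rewrite (_ : 2 * k.+1 = k.+2 + k)%N; last by rewrite mul2n -addnn addSnnS addnC.
rewrite inner_exp_split // !mul2n -!addnn !(inner_exp_split _ _ _ Th).
exact: CauchySchwarz_inner.
Qed.

(** McCarthy's inequality [<S x, x> ^ r <= <S ^ r x, x>] for a positive
    semidefinite [S] and a unit vector [x], with [S] written as the square of
    a Hermitian matrix.  The ratios of consecutive terms of a log-convex
    sequence are nondecreasing, and the sequence of moments [s] starts with 1,
    so each ratio is at least [s 1]. *)
Lemma mccarthy T r x : T ^t* = T -> inner x x = 1 ->
  inner (T ^+ 2 *m x) x ^+ r <= inner (T ^+ (2 * r) *m x) x.
Proof.
move=> Th x1; pose s k := inner (T ^+ (2 * k) *m x) x.
have s_ge0 k : 0 <= s k by exact: moment_ge0.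
have s0 : s 0 = 1 by rewrite /s muln0 expr0 mul1mx.
have ratio k : s k * s 1%N <= s k.+1.
  elim: k => [|k IH]; first by rewrite s0 mul1r.
  have := s_ge0 k.+1; rewrite le_eqVlt => /predU1P[<-|sk_gt0].
    by rewrite mul0r.
  rewrite -(ler_pM2l sk_gt0) mulrA -expr2.
  have lc : s k.+1 ^+ 2 <= s k * s k.+2 := moment_log_convex k x Th.
  apply: le_trans (ler_wpM2r (s_ge0 1%N) lc) _.
  by rewrite mulrAC ler_wpM2r.
rewrite -[T ^+ 2]/(T ^+ (2 * 1)) -/(s 1%N) -/(s r).
elim: r => [|r IH]; first by rewrite s0 expr0.
by rewrite exprSr; apply: le_trans (ler_wpM2r (s_ge0 1%N) IH) (ratio r).
Qed.

Lemma inner_proj E x : E ^t* = E -> E *m E = E ->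
  inner (E *m x) (E *m x) = inner (E *m x) x.
Proof. by move=> Eh EE; rewrite innerM Eh mulmxA EE innerM Eh. Qed.

(** The matrix [T] stands for [absmx M], and [E] for the orthogonal projection
    onto the range of [M].  Since [inner (M *m x) x] is [inner (M *m x) (E *m x)],
    Cauchy-Schwarz and McCarthy bound the left-hand side by the product of
    [inner (T ^+ (2 * r) *m x) x] and [inner (E *m x) x]; Buzano's inequality
    and the inequality of the means turn this product into the right-hand
    side. *)
Lemma proj_abs_bound (M T E : 'M[C]_n) x r :
    T ^t* = T -> M ^t* *m M = T ^+ 2 -> E ^t* = E -> E *m E = E -> E *m M = M ->
    inner x x = 1 -> (0 < r)%N ->
  `|inner (M *m x) x| ^+ (2 * r) <=
    4%:R^-1 * `|inner ((T ^+ (4 * r) + E) *m x) x|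
    + 2%:R^-1 * `|inner ((E *m T ^+ (2 * r)) *m x) x|.
Proof.
move=> Th MT Eh EE EM x1 r0.
pose a := T ^+ (2 * r) *m x; pose b := E *m x.
have bb : inner b b = inner b x by exact: inner_proj.
have bx_ge0 : 0 <= inner b x by rewrite -bb inner_ge0.
have ax_ge0 : 0 <= inner a x by exact: moment_ge0.
have xb : inner x b = inner b x by rewrite inner_conj geC0_conj.
have bx_le1 : inner b x <= 1.
  have := inner_ge0 (x - b).
  by rewrite innerBl [inner x _]inner_conj [inner b _]inner_conj !innerBl
     x1 bb xb subrr conjC0 subr0 rmorphB /= conjC1 geC0_conj // subr_ge0.
have aa : inner a a = inner (T ^+ (4 * r) *m x) x.
  by rewrite -inner_exp_split // addnn -mul2n mulnA.
have y_ge0 : 0 <= inner ((T ^+ (4 * r) + E) *m x) x.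
  by rewrite mulmxDl innerDl -aa -/b -bb addr_ge0 ?inner_ge0.
have step1 : `|inner (M *m x) x| ^+ (2 * r) <= inner a x * inner x b.
  have Mx : inner (M *m x) x = inner (M *m x) b.
    by rewrite -{1}EM -mulmxA innerM Eh.
  have MM : inner (M *m x) (M *m x) = inner (T ^+ 2 *m x) x.
    by rewrite -MT -mulmxA [RHS]innerM trmxCK.
  have t_ge0 : 0 <= inner (T ^+ 2 *m x) x by rewrite -MM inner_ge0.
  rewrite exprM Mx xb.
  apply: (@le_trans _ _ ((inner (T ^+ 2 *m x) x * inner b x) ^+ r)).
    rewrite lerXn2r ?nnegrE ?exprn_ge0 ?mulr_ge0 //.
    by have := CauchySchwarz_inner (M *m x) b; rewrite MM bb.
  rewrite exprMn; apply: ler_pM; rewrite ?exprn_ge0 ?mccarthy //.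
  (* A number of [0, 1] dominates its positive powers. *)
  by rewrite -[leRHS]expr1 ler_wiXn2l.
have step2 : inner a x * inner x b *+ 4 <=
    inner ((T ^+ (4 * r) + E) *m x) x + `|inner ((E *m T ^+ (2 * r)) *m x) x| *+ 2.
  have p_ge0 : 0 <= inner a x * inner x b by rewrite xb mulr_ge0.
  rewrite (mulrnA _ 2 2) -[X in X *+ 2 *+ 2]ger0_norm //.
  apply: le_trans (ler_wMn2r 2 (buzano a b x1)) _.
  rewrite mulrnDl -mulmxA -/a [inner (E *m a) x]innerM Eh -/b lerD2r.
  rewrite mulmxDl innerDl -aa -/b -bb.
  rewrite -[X in _ <= X + _]sqrtCK -[X in _ <= _ + X]sqrtCK.
  by apply: real_leif_mean_square_scaled;
     rewrite ger0_real ?sqrtC_ge0 ?inner_ge0.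
rewrite (ger0_norm y_ge0); apply: le_trans step1 _.
rewrite -(ler_pMn2r (n := 4)) //; apply: le_trans step2 _.
have V4 (y : C) : 4%:R^-1 * y *+ 4 = y.
  by rewrite -mulrnAr -[y *+ 4]mulr_natl mulKf // pnatr_eq0.
have V2 (y : C) : 2%:R^-1 * y *+ 2 = y.
  by rewrite -mulrnAr -[y *+ 2]mulr_natl mulKf // pnatr_eq0.
by rewrite mulrnDl V4 (mulrnA _ 2 2) V2.
Qed.

End InnerProduct.

(** * The projection onto the range of a matrix *)

(** The Penrose conditions for a Hermitian matrix are self-dual, so the adjoint
    of its pseudoinverse satisfies them too. *)
Lemma adj_mpinv (C : numClosedFieldType) n (G : 'M[C]_n) :
  G ^t* = G -> (mpinv G) ^t* = mpinv G.
Proof.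
move=> Gh; have PG := mpinvP G; apply: penrose_inj (PG).
move: (mpinv G) PG => X [GXG XGX GXh XGh]; split.
- by rewrite -[RHS]Gh -[in RHS]GXG !adjM Gh mulmxA.
- by rewrite -[in RHS]XGX !adjM Gh mulmxA.
- by rewrite (_ : G *m X ^t* = X *m G) // -[RHS]XGh adjM Gh.
- by rewrite (_ : X ^t* *m G = G *m X) // -[RHS]GXh adjM Gh.
Qed.

(** [A *m mpinv (A ^t* *m A) *m A ^t*] is the orthogonal projection onto the
    range of [A].  That it fixes [A] follows because the difference
    [D = E *m A - A] is of the form [A *m W] while [A ^t* *m D = 0], so its
    columns lie both in the range of [A] and in the orthogonal complement of
    that range. *)
Lemma range_projP (C : numClosedFieldType) m n (A : 'M[C]_(m, n)) :
  let E := A *m mpinv (A ^t* *m A) *m A ^t* in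
  [/\ E ^t* = E, E *m E = E & E *m A = A].
Proof.
move=> E; set G := A ^t* *m A in E *; set X := mpinv G in E *.
have Gh : G ^t* = G by rewrite adjM trmxCK.
have [GXG _ _ _] : penrose G X := mpinvP G.
have Xh : X ^t* = X by exact: adj_mpinv.
have EA : E *m A = A.
  apply/eqP; rewrite -subr_eq0; apply/eqP/adj_mul_eq0.
  have AD : A ^t* *m (E *m A - A) = 0.
    by rewrite mulmxBr /E !mulmxA -/G -mulmxA -/G GXG subrr.
  rewrite adjB mulmxBl AD subr0.
  have -> : (E *m A) ^t* = (X *m G) ^t* *m A ^t*.
    by rewrite -adjM /E -!mulmxA.
  by rewrite -mulmxA AD mulmx0.
split=> //; first by rewrite !adjM trmxCK Xh mulmxA.
by rewrite {2}/E !mulmxA EA.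
Qed.

(** * Berezin numbers of block matrices *)

Section BlockKernels.
Variables (R : realType) (n : nat).
Implicit Types (A B : 'M[R[i]]_n) (ij : 'I_n * 'I_n).

Local Notation normc := ComplexField.Normc.normc.
Local Notation "x %:C" := (real_complex R x).
Local Notation blockdiag A B := (block_mx A 0 0 B).

Lemma adj_blockdiag A B : (blockdiag A B) ^t* = blockdiag (A ^t*) (B ^t*).
Proof. by rewrite tr_block_mx map_block_mx !trmx0 !map_mx0. Qed.

Lemma mul_blockdiag A1 B1 A2 B2 :
  blockdiag A1 B1 *m blockdiag A2 B2 = blockdiag (A1 *m A2) (B1 *m B2).
Proof. by rewrite mulmx_block !mul0mx !mulmx0 !addr0 !add0r. Qed.

Lemma exp_blockdiag A B k : blockdiag A B ^+ k = blockdiag (A ^+ k) (B ^+ k).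
Proof.
elim: k => [|k IH]; first by rewrite !expr0; apply: scalar_mx_block.
by rewrite !exprS IH -[_ * _]/(_ *m _) mul_blockdiag.
Qed.

Lemma inner_basis_vec (j : 'I_n) : inner (basis_vec R j) (basis_vec R j) = 1.
Proof.
rewrite /inner /basis_vec trmx_delta map_delta_mx mul_delta_mx.
by rewrite mxE !eqxx.
Qed.

Lemma inner_col_mx (u1 u2 v1 v2 : 'cV[R[i]]_n) :
  inner (col_mx u1 u2) (col_mx v1 v2) = inner u1 v1 + inner u2 v2.
Proof. by rewrite /inner tr_col_mx map_row_mx mul_row_col mxE. Qed.

(** The factor [2^-1] is the square of the normalization [1 / sqrt 2], so the
    quadratic form of a block diagonal matrix at a kernel is the average of
    two diagonal entries. *)
Lemma inner_blockdiag_kernel A B ij :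
  inner (blockdiag A B *m block_kernel R ij) (block_kernel R ij) =
  2%:R^-1 * (inner (A *m basis_vec R ij.1) (basis_vec R ij.1)
             + inner (B *m basis_vec R ij.2) (basis_vec R ij.2)).
Proof.
rewrite /block_kernel -scalemxAr innerZl inner_conj innerZl rmorphM /=.
rewrite -inner_conj mulrA mul_block_col !mul0mx addr0 add0r inner_col_mx.
congr (_ * _).
set x := _^-1; have -> : (x%:C)^* = x%:C :> R[i] by exact: conjc_real.
rewrite -rmorphM /= /x -invfM -expr2 sqr_sqrtr ?ler0n //.
by rewrite fmorphV rmorph_nat.
Qed.

Lemma inner_block_kernel ij : inner (block_kernel R ij) (block_kernel R ij) = 1.
Proof.
have := inner_blockdiag_kernel 1%:M 1%:M ij.
rewrite -scalar_mx_block !mul1mx !inner_basis_vec => ->.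
by rewrite -[1 + 1]/(2%:R) mulVf // pnatr_eq0.
Qed.

Lemma normr_normc (z : R[i]) : `|z| = (normc z)%:C.
Proof. by []. Qed.

Lemma normc_ge0 (z : R[i]) : 0 <= normc z.
Proof. by case: z => a b; apply: sqrtr_ge0. Qed.

Lemma normc_diag_le_ber A (j : 'I_n) :
  normc (inner (A *m basis_vec R j) (basis_vec R j)) <= ber A.
Proof.
exact: (le_bigmax 0 (fun j => normc (inner (A *m basis_vec R j) (basis_vec R j)))).
Qed.

Lemma normc_blockdiag_le A B ij :
  normc (inner (blockdiag A B *m block_kernel R ij) (block_kernel R ij)) <=
  Num.max (ber A) (ber B).
Proof.
have half : normc (2%:R^-1 : R[i]) = 2%:R^-1.
  apply: complexI; rewrite -[LHS]/(`|2%:R^-1 : R[i]|) ger0_norm ?invr_ge0 ?ler0n //.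
  by rewrite fmorphV rmorph_nat.
rewrite inner_blockdiag_kernel ComplexField.Normc.normcM half.
rewrite mulrC ler_pdivrMr ?ltr0n // mulr_natr mulr2n.
apply: le_trans (le_normcD _ _) _.
by apply: lerD; apply: le_trans (normc_diag_le_ber _ _) _;
   rewrite le_max lexx ?orbT.
Qed.

Lemma ber_block_exp_le (M : 'M[R[i]]_(n + n)) k (c : R) :
    (0 < n)%N -> (0 < k)%N ->
    (forall ij, normc (inner (M *m block_kernel R ij) (block_kernel R ij)) ^+ k <= c) ->
  ber_block M ^+ k <= c.
Proof.
move=> n0 k0 Mc; rewrite /ber_block /berezin.
elim/big_ind: _ => [|x y xc yc|ij _]; last exact: Mc; last first.
  by rewrite /Num.max; case: ifP.
rewrite expr0n gtn_eqF //; apply: le_trans (Mc (Ordinal n0, Ordinal n0)).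
by apply: exprn_ge0; exact: normc_ge0.
Qed.

End BlockKernels.

(** Everything the bound uses about the moduli and the pseudoinverses: the
    matrices [SP] and [SQ] stand for [absmx P] and [absmx Q], the matrices [EP]
    and [EQ] for the projections onto the ranges of [P] and [Q].  Since the
    off-diagonal block matrix has modulus [diag (SQ, SP)] and range projection
    [diag (EP, EQ)], the operator bound [proj_abs_bound] at each kernel is one
    about block diagonal matrices. *)
Lemma offdiag_ber_bound (R : realType) (n : nat)
    (P Q SP SQ EP EQ : 'M[R[i]]_n) (r : nat) :
    (0 < n)%N -> (0 < r)%N ->
    SP ^t* = SP -> SQ ^t* = SQ -> P ^t* *m P = SP ^+ 2 -> Q ^t* *m Q = SQ ^+ 2 ->
    [/\ EP ^t* = EP, EP *m EP = EP & EP *m P = P] ->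
    [/\ EQ ^t* = EQ, EQ *m EQ = EQ & EQ *m Q = Q] ->
  ber_block (block_mx 0 P Q 0) ^+ (2 * r) <=
    4%:R^-1 * Num.max (ber (SQ ^+ (4 * r) + EP)) (ber (SP ^+ (4 * r) + EQ))
    + 2%:R^-1 * Num.max (ber (EP *m SQ ^+ (2 * r))) (ber (EQ *m SP ^+ (2 * r))).
Proof.
move=> hn hr SPh SQh PS QS [EPh EPP EPA] [EQh EQQ EQA].
apply: ber_block_exp_le; rewrite ?muln_gt0 // => ij.
pose T := block_mx SQ 0 0 SP.
pose E := block_mx EP 0 0 EQ.
have Th : T ^t* = T by rewrite adj_blockdiag SPh SQh.
have Eh : E ^t* = E by rewrite adj_blockdiag EPh EQh.
have EE : E *m E = E by rewrite mul_blockdiag EPP EQQ.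
have EM : E *m block_mx 0 P Q 0 = block_mx 0 P Q 0.
  by rewrite mulmx_block !mul0mx !mulmx0 !addr0 !add0r EPA EQA.
have MT : (block_mx 0 P Q 0) ^t* *m block_mx 0 P Q 0 = T ^+ 2.
  rewrite exp_blockdiag -PS -QS tr_block_mx map_block_mx !trmx0 !map_mx0.
  by rewrite mulmx_block !mul0mx !mulmx0 !addr0 !add0r.
have := proj_abs_bound Th MT Eh EE EM (inner_block_kernel R ij) hr.
rewrite !exp_blockdiag mul_blockdiag add_block_mx !addr0.
rewrite !normr_normc -(rmorph_nat (real_complex R) 4).
rewrite -(rmorph_nat (real_complex R) 2) -!fmorphV -!rmorphM -rmorphD -rmorphXn.
rewrite lecR => bound; apply: le_trans bound _.
by apply: lerD; rewrite ler_pM2l ?invr_gt0 ?ltr0n //; apply: normc_blockdiag_le.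
Qed.

Theorem corollary2p8 (R : realType) (n : nat) (hn : (0 < n)%N)
    (P Q : 'M[R[i]]_n) (r : nat) (hr : (0 < r)%N) :
  ber_block (block_mx 0 P Q 0) ^+ (2 * r) <=
    4%:R^-1 * Num.max
      (ber (absmx Q ^+ (4 * r) + P *m mpinv (absmx P ^+ 2) *m P ^t*))
      (ber (absmx P ^+ (4 * r) + Q *m mpinv (absmx Q ^+ 2) *m Q ^t*))
    + 2%:R^-1 * Num.max
      (ber (P *m mpinv (absmx P ^+ 2) *m P ^t* *m absmx Q ^+ (2 * r)))
      (ber (Q *m mpinv (absmx Q ^+ 2) *m Q ^t* *m absmx P ^+ (2 * r))).
Proof.
have abs_adj (A : 'M[R[i]]_n) : (absmx A) ^t* = absmx A.
  by have [[]] := sqrtmxP (psdmx_gram A).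
apply: offdiag_ber_bound; rewrite ?abs_adj ?absmx_sqr //; exact: range_projP.
Qed.
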